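(* Let $(M,g)$ be a compact Riemannian manifold without boundary, let $H\subset M$ be a smooth hypersurface, and let $\mu$ be a probability measure on $S^*M$ invariant under the flow $\phi_t=\exp(tH_p)$, $p(x,\xi)=|\xi|_g^2$. If the second fundamental form of $H$ is non-degenerate, then $\mu|_{S^*_HM}=0$.
   Context: $S^*M$ is the unit cosphere bundle of $(M,g)$, $H_p$ is the Hamilton vector field of $p$, and $\phi_t$ is the geodesic flow on $S^*M$. $S^*_HM=\{(x,\xi)\in S^*M:x\in H\}$, and $\mu|_{S^*_HM}=\mathbf 1_{S^*_HM}\,\mu$ is the restriction of $\mu$ to $S^*_HM$. The second fundamental form of $H$ is the symmetric tensor on $TH$ given by $II(X,Y)=\nabla^M_XY-\nabla^H_XY$, where $\nabla^M$ and $\nabla^H$ are the covariant derivatives of $(M,g)$ and $(H,g|_H)$. It defines a quadratic form at each point $x'\in H$, written as a quadratic polynomial $Q(0,x',\xi')$ in $\xi'$. In Fermi normal coordinates $(x',x_n)$ near $H=\{x_n=0\}$, with dual coordinates $(\xi',\xi_n)$, one has $p=\xi_n^2+R_2(x',x_n,\xi')$ with $R_2$ quadratic in $\xi'$, and $Q(0,x',\xi')=\tfrac12\partial_{x_n}R_2(x',0,\xi')$.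
   Formalization: ''Non-degenerate'' is taken to mean II(X,X)≠0 for every nonzero tangent X (Q has no nontrivial zero); with mere trivial radical the claim is false, e.g. for the Clifford torus in the round S^3, which contains great circles. *)

(* Defs.v *)
From HB Require Import structures.
From mathcomp Require Import all_boot all_order all_algebra.
From mathcomp Require Import all_classical all_reals all_analysis.
Import Order.TTheory GRing.Theory Num.Theory.
Import numFieldNormedType.Exports.

Set Implicit Arguments.
Unset Strict Implicit.
Unset Printing Implicit Defensive.

Local Open Scope classical_set_scope.
Local Open Scope ring_scope.

(* [U] is meant to be open: values of [f] off [U] are then irrelevant. *)
Fixpoint Ck_on (R : realType) (V W : normedModType R) (k : nat)
    (U : set V) (f : V -> W) : Prop :=
  match k with
  | 0 => forall x, U x -> {for x, continuous f}
  | k'.+1 => (forall x, U x -> differentiable f x) /\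
             (forall v, Ck_on k' U (fun x => 'D_v f x))
  end.

Definition smooth_on (R : realType) (V W : normedModType R)
    (U : set V) (f : V -> W) : Prop :=
  forall k, Ck_on k U f.

(* Coordinates and tangent vectors are row vectors, covectors are columns, so
   that the pairing is [v *m xi] and tangent vectors transform under a map [f]
   by right multiplication with the library's [jacobian f]. *)

(* [cmap] is a homeomorphism of [cdom] onto the open set [cimg]; [cmap] and
   its inverse [cinv] are junk off these sets. *)
Record chart (R : realType) (M : topologicalType) (d : nat) := Chart {
  cdom : set M;
  cmap : M -> 'rV[R]_d;
  cinv : 'rV[R]_d -> M;
  cdom_open : open cdom;
  cimg_open : open (cmap @` cdom);
  cmapK : forall x, cdom x -> cinv (cmap x) = x;
  cmap_continuous : forall x, cdom x -> {for x, continuous cmap};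
  cinv_continuous :
    forall u, (cmap @` cdom) u -> {for u, continuous cinv} }.

Definition cimg (R : realType) (M : topologicalType) (d : nat)
  (c : chart R M d) : set 'rV[R]_d := cmap c @` cdom c.

Definition transition (R : realType) (M : topologicalType) (d : nat)
  (c c' : chart R M d) : 'rV[R]_d -> 'rV[R]_d := cmap c' \o cinv c.

Definition smooth_transition (R : realType) (M : topologicalType) (d : nat)
    (c c' : chart R M d) : Prop :=
  smooth_on (cmap c @` (cdom c `&` cdom c')) (transition c c').

(* C^oo manifold of dimension [d] without boundary; [atlas] is the maximal
   smooth atlas. *)
Record manifold (R : realType) (d : nat) := Manifold {
  mspace :> topologicalType;
  atlas : set (chart R mspace d);
  mhausdorff : hausdorff_space mspace;
  msecond_countable : @second_countable mspace;
  atlas_cover : forall x : mspace, exists2 c, atlas c & cdom c x;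
  atlas_smooth :
    forall c c', atlas c -> atlas c' -> smooth_transition c c';
  atlas_maximal : forall c,
    (forall c', atlas c' -> smooth_transition c c' /\ smooth_transition c' c) ->
    atlas c }.

Arguments atlas {R d} m.

(* [gmx c u] is the matrix of the metric in the chart [c] at the point with
   coordinates [u]. *)
Record metric (R : realType) (d : nat) (M : manifold R d) := Metric {
  gmx : chart R M d -> 'rV[R]_d -> 'M[R]_d;
  gmx_smooth : forall c, atlas M c -> smooth_on (cimg c) (gmx c);
  gmx_sym : forall c u, atlas M c -> cimg c u -> (gmx c u)^T = gmx c u;
  gmx_pos : forall c u (v : 'rV[R]_d), atlas M c -> cimg c u -> v != 0 ->
    0 < (v *m gmx c u *m v^T) 0 0;
  gmx_change : forall c c' x, atlas M c -> atlas M c' ->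
    cdom c x -> cdom c' x ->
    gmx c (cmap c x) =
      jacobian (transition c c') (cmap c x) *m gmx c' (cmap c' x) *m
        (jacobian (transition c c') (cmap c x))^T }.

(* A covector is given by its components in all charts around its base point,
   related by the covariant transformation rule. The components in the other
   charts carry no information and are set to 0. *)
Record cotangent (R : realType) (d : nat) (M : manifold R d) := Cotangent {
  base : M;
  comp : chart R M d -> 'cV[R]_d;
  comp_change : forall c c', atlas M c -> atlas M c' ->
    cdom c base -> cdom c' base ->
    comp c = jacobian (transition c c') (cmap c base) *m comp c';
  comp_out : forall c, ~ (atlas M c /\ cdom c base) -> comp c = 0 }.

(* p(x, xi) = |xi|_g^2 in the chart [c]. *)
Definition symb (R : realType) (d : nat) (M : manifold R d) (g : metric M)
    (c : chart R M d) (u : 'rV[R]_d) (eta : 'cV[R]_d) : R :=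
  (eta^T *m invmx (gmx g c u) *m eta) 0 0.

(* S^*M *)
Record cosphere (R : realType) (d : nat) (M : manifold R d) (g : metric M) :=
  Cosphere {
  cvec :> cotangent M;
  cvec_unit : forall c, atlas M c -> cdom c (base cvec) ->
    symb g c (cmap c (base cvec)) (comp cvec c) = 1 }.

Definition ccoord (R : realType) (d : nat) (M : manifold R d)
    (c : chart R M d) (xi : cotangent M) : 'rV[R]_d * 'cV[R]_d :=
  (cmap c (base xi), comp xi c).

HB.instance Definition _ (R : realType) (d : nat) (M : manifold R d)
  (g : metric M) := gen_eqMixin (cosphere g).
HB.instance Definition _ (R : realType) (d : nat) (M : manifold R d)
  (g : metric M) := gen_choiceMixin (cosphere g).

(* The topology of S^*M: open means relatively open in the canonical
   coordinates (x, xi) over every chart. *)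
Definition cosphere_open (R : realType) (d : nat) (M : manifold R d)
    (g : metric M) (A : set (cosphere g)) : Prop :=
  forall c, atlas M c ->
    exists2 O : set ('rV[R]_d * 'cV[R]_d), open O &
      forall rho : cosphere g, cdom c (base rho) ->
        (A rho <-> O (ccoord c rho)).

Section CosphereTopology.
Context (R : realType) (d : nat) (M : manifold R d) (g : metric M).

Let cosphere_openT : @cosphere_open R d M g setT.
Proof. by move=> c _; exists setT; first exact: openT. Qed.

Let cosphere_openI : setI_closed (@cosphere_open R d M g).
Proof.
move=> A B oA oB c ac; have [U oU UA] := oA c ac.
have [V oV VB] := oB c ac.
exists (U `&` V); first exact: openI.
by move=> rho cr; split=> -[/(UA _ cr) ? /(VB _ cr) ?].
Qed.

Let cosphere_open_bigU (I : Type) (f : I -> set (cosphere g)) :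
  (forall i, cosphere_open (f i)) -> cosphere_open (\bigcup_i f i).
Proof.
move=> of_ c ac; pose O i := sval (cid2 (of_ i c ac)).
have oO i : open (O i) by rewrite /O; case: cid2.
have HO i rho : cdom c (base (cvec rho)) ->
    (f i rho <-> O i (ccoord c rho)).
  by rewrite /O; case: cid2 => //= ? _; apply.
exists (\bigcup_i O i); first exact: bigcup_open.
by move=> rho cr; split=> -[i _ /(HO _ _ cr) ?]; exists i.
Qed.

HB.instance Definition _ := isOpenTopological.Build (cosphere g)
  cosphere_openT cosphere_openI cosphere_open_bigU.

End CosphereTopology.

(* S^*M as a pointed type, with its Borel sigma-algebra: the library's
   measurable types have to be inhabited. The sigma-algebra does not depend on
   the point, and S^*M is inhabited as soon as it carries a probability. *)
Definition pcosphere (R : realType) (d : nat) (M : manifold R d)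
  (g : metric M) (rho0 : cosphere g) : Type := cosphere g.

HB.instance Definition _ (R : realType) (d : nat) (M : manifold R d)
  (g : metric M) (rho0 : cosphere g) :=
  Topological.copy (pcosphere rho0) (cosphere g).
HB.instance Definition _ (R : realType) (d : nat) (M : manifold R d)
  (g : metric M) (rho0 : cosphere g) :=
  isPointed.Build (pcosphere rho0) rho0.

Notation borel_cosphere rho0 :=
  (g_sigma_algebraType (@open (pcosphere rho0))).

(* The two components (d p / d xi, - d p / d x) of the Hamilton vector field
   H_p in the chart [c]. *)
Definition ham_x (R : realType) (d : nat) (M : manifold R d) (g : metric M)
    (c : chart R M d) (u : 'rV[R]_d) (eta : 'cV[R]_d) : 'rV[R]_d :=
  \row_i 'D_(delta_mx i 0) (symb g c u) eta.

Definition ham_xi (R : realType) (d : nat) (M : manifold R d) (g : metric M)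
    (c : chart R M d) (u : 'rV[R]_d) (eta : 'cV[R]_d) : 'cV[R]_d :=
  \col_i - 'D_(delta_mx 0 i) (fun w => symb g c w eta) u.

(* phi_t = exp(t H_p) on S^*M: the (unique) continuous one-parameter group
   generated by H_p. *)
Definition geodesic_flow (R : realType) (d : nat) (M : manifold R d)
    (g : metric M) (phi : R -> cosphere g -> cosphere g) : Prop :=
  [/\ continuous (fun z : R * cosphere g => phi z.1 z.2),
      (forall rho, phi 0 rho = rho),
      (forall s t rho, phi (s + t) rho = phi s (phi t rho)) &
      forall rho t c, atlas M c -> cdom c (base (phi t rho)) ->
        is_derive t (1 : R) (fun s => cmap c (base (phi s rho)))
          (ham_x g c (cmap c (base (phi t rho))) (comp (phi t rho) c)) /\
        is_derive t (1 : R) (fun s => comp (phi s rho) c)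
          (ham_xi g c (cmap c (base (phi t rho))) (comp (phi t rho) c))].

Definition flow_invariant (R : realType) (d : nat) (M : manifold R d)
    (g : metric M) (rho0 : cosphere g)
    (phi : R -> cosphere g -> cosphere g)
    (mu : set (borel_cosphere rho0) -> \bar R) : Prop :=
  forall t (A : set (borel_cosphere rho0)), measurable A ->
    mu (phi t @^-1` A) = mu A.

Definition slice_chart (R : realType) (n : nat) (M : manifold R n.+1)
    (H : set M) (c : chart R M n.+1) : Prop :=
  atlas M c /\ forall x, cdom c x -> (H x <-> cmap c x 0 ord_max = 0).

(* Embedded, not necessarily closed. *)
Definition hypersurface (R : realType) (n : nat) (M : manifold R n.+1)
    (H : set M) : Prop :=
  forall x, H x -> exists2 c, slice_chart H c & cdom c x.

(* S^*_H M *)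
Definition cosphere_over (R : realType) (d : nat) (M : manifold R d)
    (g : metric M) (H : set M) : set (cosphere g) :=
  [set rho | H (base rho)].

Arguments cosphere_over {R d M} g H.

(* In coordinates on an open subset of R^m with metric matrix [h]: the
   Christoffel symbol Gamma^k_{ij} and the Levi-Civita covariant derivative
   nabla_X Y. *)
Definition christoffel (R : realType) (m : nat)
    (h : 'rV[R]_m -> 'M[R]_m) (u : 'rV[R]_m) (k i j : 'I_m) : R :=
  2^-1 * \sum_l invmx (h u) k l *
    ('D_(delta_mx 0 i) (fun w => h w j l) u +
     'D_(delta_mx 0 j) (fun w => h w i l) u -
     'D_(delta_mx 0 l) (fun w => h w i j) u).

Definition covariant (R : realType) (m : nat) (h : 'rV[R]_m -> 'M[R]_m)
    (X Y : 'rV[R]_m -> 'rV[R]_m) (u : 'rV[R]_m) : 'rV[R]_m :=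
  'D_(X u) Y u +
  \row_k \sum_i \sum_j christoffel h u k i j * X u 0 i * Y u 0 j.

(* y |-> (y, 0), the inclusion of H and of TH in a slice chart. *)
Definition slice_incl (R : realType) (n : nat) (y : 'rV[R]_n) : 'rV[R]_n.+1 :=
  \row_j (if unlift ord_max j is Some i then y 0 i else 0).

(* g|_H in the coordinates of H given by the slice chart [c]. *)
Definition induced (R : realType) (n : nat) (M : manifold R n.+1)
    (g : metric M) (c : chart R M n.+1) (y : 'rV[R]_n) : 'M[R]_n :=
  \matrix_(i, j) gmx g c (slice_incl y) (lift ord_max i) (lift ord_max j).

(* II(X, Y) = nabla^M_X Y - nabla^H_X Y at the point of H with coordinates [y]
   in the slice chart [c]. As II is a tensor, X and Y may be extended by
   constant coefficients. *)
Definition second_ff (R : realType) (n : nat) (M : manifold R n.+1)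
    (g : metric M) (c : chart R M n.+1) (y X Y : 'rV[R]_n) : 'rV[R]_n.+1 :=
  covariant (gmx g c) (fun=> slice_incl X) (fun=> slice_incl Y) (slice_incl y)
  - slice_incl (covariant (induced g c) (fun=> X) (fun=> Y) y).

(* Non-degeneracy of the quadratic form X |-> II(X, X), i.e. of Q(0, x', .):
   it has no nontrivial zero. The weaker condition that the symmetric bilinear
   form II has trivial radical does not suffice for the theorem: along the axis
   of a helicoid in a flat 3-torus it holds, but the axis is a closed geodesic
   of the torus contained in the helicoid. *)
Definition second_ff_nondegenerate (R : realType) (n : nat)
    (M : manifold R n.+1) (g : metric M) (H : set M) : Prop :=
  forall c, slice_chart H c -> forall y, cimg c (slice_incl y) ->
    forall X, second_ff g c y X X = 0 -> X = 0.

(* Main.v *)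
Require Import Defs.
From HB Require Import structures.
From mathcomp Require Import all_boot all_order all_algebra.
From mathcomp Require Import all_classical all_reals all_analysis.
From mathcomp Require Import ring.
Import Order.TTheory GRing.Theory Num.Theory.
Import numFieldNormedType.Exports.
Local Open Scope classical_set_scope.
Local Open Scope ring_scope.

Set Implicit Arguments.
Unset Strict Implicit.
Unset Printing Implicit Defensive.

(** A geodesic can meet H only at isolated times. In a slice chart, where H is
    {x_n = 0}, let v = G^-1 xi be half the velocity of an orbit of the flow.
    At a point of H, either v_n <> 0 and the orbit crosses H transversally, or
    v is tangent to H and, by the geodesic equation, the n-th component of
    dv/dt is -2 Gamma^n(v, v). The vector II(v, v) is normal to H with n-th
    component Gamma^n(v, v), so if that number vanished then so would II(v, v)
    ([second_ff_eq0]), hence v = 0 by non-degeneracy, which is absurd on the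
    unit cosphere bundle.

    So over the chart S^*_H M is covered by two pieces of the same kind
    ([transverse_or_curved]): the zeros of F at which F' <> 0, where (F, F') is
    either (x_n, 2 v_n) or (2 v_n, 2 dv_n/dt), and F' is the derivative of F
    along the flow. The tangential piece is thus treated as a set of transverse
    zeros of v_n, not as a set of double zeros of x_n, so that one argument
    serves for both.

    Such a set is null for any invariant probability
    ([transverse_zeros_null]). It is a countable union of sets E whose orbits
    stay in {F' <> 0} for a time e. By Rolle's theorem no orbit meets E twice
    within time e, so the preimages of E under phi_t, 0 <= t <= e, are
    disjoint; they all have the same mass, and infinitely many of them fit in a
    space of mass 1. Countably many slice charts cover H, which concludes. *)

(** * Limits and derivatives of matrix-valued functions *)

Lemma cvg_mx (R : realType) (T : Type) (F : set_system T) (m n : nat)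
    (f : T -> 'M[R]_(m, n)) (l : 'M[R]_(m, n)) {FF : Filter F} :
  (forall i j, f x i j @[x --> F] --> l i j) -> f @ F --> l.
Proof.
move=> fl; apply/cvgrPdist_le => /= e e0; near=> x.
rewrite /Num.Def.normr/= mx_normrE (bigmax_le _ (ltW e0))//= => ij _.
rewrite !mxE/=.
move: ij; near: x; apply: filter_forall => /= ij.
exact: ((cvgrPdist_le _ _).1 (fl ij.1 ij.2)).
Unshelve. all: by end_near. Qed.

Lemma cvg_mxE (R : realType) (T : Type) (F : set_system T) (m n : nat)
    (f : T -> 'M[R]_(m, n)) (l : 'M[R]_(m, n)) i j {FF : Filter F} :
  f @ F --> l -> f x i j @[x --> F] --> l i j.
Proof.
move=> fl; apply: (@cvg_comp _ _ _ f (fun M : 'M[R]_(m, n) => M i j)).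
  exact: fl.
exact: coord_continuous.
Qed.

Lemma cvg_sum (R : realType) (T I : Type) (F : set_system T) (r : seq I)
    (P : pred I) (f : I -> T -> R) (l : I -> R) {FF : Filter F} :
  (forall i, P i -> f i x @[x --> F] --> l i) ->
  \sum_(i <- r | P i) f i x @[x --> F] --> \sum_(i <- r | P i) l i.
Proof. by move=> fl; apply: cvg_big => //; exact: add_continuous. Qed.

Lemma cvg_prod (R : realType) (T I : Type) (F : set_system T) (r : seq I)
    (P : pred I) (f : I -> T -> R) (l : I -> R) {FF : Filter F} :
  (forall i, P i -> f i x @[x --> F] --> l i) ->
  \prod_(i <- r | P i) f i x @[x --> F] --> \prod_(i <- r | P i) l i.
Proof. by move=> fl; apply: cvg_big => //; exact: mul_continuous. Qed.

Lemma cvg_mulmx (R : realType) (T : Type) (F : set_system T) (m n p : nat)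
    (f : T -> 'M[R]_(m, n)) (g : T -> 'M[R]_(n, p))
    (a : 'M[R]_(m, n)) (b : 'M[R]_(n, p)) {FF : Filter F} :
  f @ F --> a -> g @ F --> b -> f x *m g x @[x --> F] --> a *m b.
Proof.
move=> fa gb; apply: cvg_mx => i j; rewrite mxE.
under eq_cvg do rewrite mxE.
by apply: cvg_sum => k _; apply: cvgM; exact: cvg_mxE.
Qed.

Lemma cvg_trmx (R : realType) (T : Type) (F : set_system T) (m n : nat)
    (f : T -> 'M[R]_(m, n)) (a : 'M[R]_(m, n)) {FF : Filter F} :
  f @ F --> a -> (f x)^T @[x --> F] --> a^T.
Proof.
move=> fa; apply: cvg_mx => i j; rewrite mxE.
by under eq_cvg do rewrite mxE; exact: cvg_mxE.
Qed.

Lemma cvg_det (R : realType) (T : Type) (F : set_system T) (n : nat)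
    (f : T -> 'M[R]_n) (a : 'M[R]_n) {FF : Filter F} :
  f @ F --> a -> \det (f x) @[x --> F] --> \det a.
Proof.
move=> fa; apply: cvg_sum => s _; apply: cvgMl_tmp.
by apply: cvg_prod => i _; exact: cvg_mxE.
Qed.

Lemma cvg_unitmx (R : realType) (T : Type) (F : set_system T) (n : nat)
    (f : T -> 'M[R]_n) (a : 'M[R]_n) {FF : Filter F} :
  a \in unitmx -> f @ F --> a -> \forall x \near F, f x \in unitmx.
Proof.
rewrite unitmxE unitfE => ua fa.
by near do rewrite unitmxE unitfE; apply: cvgr_neq0 ua; exact: cvg_det.
Unshelve. all: by end_near. Qed.

(** Near an invertible matrix the inverse is the adjugate over the determinant,
    which is a rational expression in the entries. *)
Lemma cvg_invmx (R : realType) (T : Type) (F : set_system T) (n : nat)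
    (f : T -> 'M[R]_n) (a : 'M[R]_n) {FF : Filter F} :
  a \in unitmx -> f @ F --> a -> invmx (f x) @[x --> F] --> invmx a.
Proof.
move=> ua fa.
have uf := cvg_unitmx ua fa.
have adjfa : \adj (f x) @[x --> F] --> \adj a.
  apply: cvg_mx => i j; rewrite mxE.
  under eq_cvg do rewrite mxE.
  apply: cvgMl_tmp; apply: cvg_det; apply: cvg_mx => k l; rewrite !mxE.
  by under eq_cvg do rewrite !mxE; exact: cvg_mxE.
rewrite {2}/invmx ua.
apply: (@cvg_trans _ ((fun x => (\det (f x))^-1 *: \adj (f x)) @ F)).
  apply: near_eq_cvg; near=> x.
  have ufx : f x \in unitmx by near: x; exact: uf.
  by rewrite /invmx ufx.
apply: cvgZ => //; apply: cvgV; last exact: cvg_det.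
by move: ua; rewrite unitmxE unitfE.
Unshelve. all: by end_near. Qed.

Lemma is_derive_mx (R : realType) (V : normedModType R) (m n : nat)
    (f : V -> 'M[R]_(m, n)) x v (df : 'M[R]_(m, n)) :
  (forall i j, is_derive x v (fun y => f y i j) (df i j)) ->
  is_derive x v f df.
Proof.
move=> dfij.
have fx : derivable f x v by apply/derivable_mxP => i j; have [] := dfij i j.
split=> //; rewrite derive_mx//; apply/matrixP => i j; rewrite mxE.
by have [_] := dfij i j.
Qed.

Lemma is_derive_mxE (R : realType) (V : normedModType R) (m n : nat)
    (f : V -> 'M[R]_(m, n)) x v (df : 'M[R]_(m, n)) i j :
  is_derive x v f df -> is_derive x v (fun y => f y i j) (df i j).
Proof.
move=> [fx <-]; split; first by move/derivable_mxP : fx; exact.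
by rewrite derive_mx// mxE.
Qed.

Lemma is_derive_trmx (R : realType) (V : normedModType R) (m n : nat)
    (f : V -> 'M[R]_(m, n)) x v (df : 'M[R]_(m, n)) :
  is_derive x v f df -> is_derive x v (fun y => (f y)^T) df^T.
Proof.
move=> dfx; apply: is_derive_mx => i j; rewrite mxE.
under [fun _ => _]funext do rewrite mxE.
exact: is_derive_mxE.
Qed.

Lemma is_derive_mulmx (R : realType) (V : normedModType R) (m n p : nat)
    (f : V -> 'M[R]_(m, n)) (g : V -> 'M[R]_(n, p)) x v
    (df : 'M[R]_(m, n)) (dg : 'M[R]_(n, p)) :
  is_derive x v f df -> is_derive x v g dg ->
  is_derive x v (fun y => f y *m g y) (df *m g x + f x *m dg).
Proof.
move=> dfx dgx; apply: is_derive_mx => i j.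
have -> : (fun y => (f y *m g y) i j) =
    \sum_k ((fun y => f y i k) * (fun y => g y k j)).
  by apply/funext => y; rewrite mxE fct_sumE.
rewrite !mxE -big_split/=; apply: is_derive_sum => k.
apply: is_derive_eq.
  by apply: is_deriveM; apply: is_derive_mxE; eassumption.
rewrite /GRing.scale/=; by rewrite addrC; congr (_ + _); rewrite mulrC.
Qed.

Lemma derivable_cvg (R : realType) (V W : normedModType R) (f : V -> W) x v :
  derivable f x v -> f (h *: v + x) @[h --> (0:R)^'] --> f x.
Proof.
move=> fx.
suff : {for 0, continuous (fun h : R => f(h *: v + x))}.
  by move=> /continuous_withinNx; rewrite scale0r add0r.
exact/differentiable_continuous/derivable1_diffP/(derivable1P _ _ _).1.
Qed.

(** The difference quotient of the inverse is exactly
    - A_h^-1 ((A_h - A_0) / h) A_0^-1, so continuity of the inverse is all that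
    the limit requires. *)
Lemma is_derive_invmx (R : realType) (V : normedModType R) (n : nat)
    (f : V -> 'M[R]_n) x v (df : 'M[R]_n) : f x \in unitmx ->
  is_derive x v f df ->
  is_derive x v (fun y => invmx (f y)) (- (invmx (f x) *m df *m invmx (f x))).
Proof.
move=> ux [fx <-].
have cf := derivable_cvg fx.
have uf := cvg_unitmx ux cf.
suff lim : h^-1 *: (invmx (f (h *: v + x)) - invmx (f x)) @[h --> (0:R)^'] -->
    - (invmx (f x) *m 'D_v f x *m invmx (f x)).
  split; last exact: cvg_lim lim.
  exact: cvgP lim.
apply: (@cvg_trans _ ((fun h => - (invmx (f (h *: v + x)) *m
    (h^-1 *: (f (h *: v + x) - f x)) *m invmx (f x))) @ (0:R)^')).
  apply: near_eq_cvg; near=> h.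
  have uh : f (h *: v + x) \in unitmx by near: h; exact: uf.
  rewrite /= -scalemxAr -scalemxAl mulmxBr mulVmx// mulmxBl mul1mx.
  by rewrite -mulmxA mulmxV// mulmx1 -scalerN opprB.
apply: cvgN; apply: cvg_mulmx; last exact: cvg_cst.
by apply: cvg_mulmx; [exact: cvg_invmx | exact: fx].
Unshelve. all: by end_near. Qed.

Lemma is_derive_comp (R : realType) (V W : normedModType R) (f : V -> W)
    (u : R -> V) t u' : differentiable f (u t) -> is_derive t (1 : R) u u' ->
  is_derive t (1 : R) (fun s => f (u s)) ('D_u' f (u t)).
Proof.
move=> df [/derivable1_diffP du <-].
have dfu : differentiable (f \o u) t by exact: differentiable_comp.
split; first exact/derivable1_diffP.
by rewrite (deriveE _ df) (deriveE _ du) (deriveE _ dfu) diff_comp.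
Qed.

Lemma derive_coord_sum (R : realType) (W : normedModType R) (d : nat)
    (f : 'rV[R]_d -> W) u v : differentiable f u ->
  'D_v f u = \sum_k v 0 k *: 'D_(delta_mx 0 k) f u.
Proof.
move=> df; rewrite deriveE// {1}(row_sum_delta v) linear_sum.
by apply: eq_bigr => k _; rewrite linearZ/= deriveE.
Qed.

(** A left kernel vector v of A would give v A v^T = 0. *)
Lemma posdef_unitmx (R : realType) (d : nat) (A : 'M[R]_d) :
  (forall v : 'rV[R]_d, v != 0 -> 0 < (v *m A *m v^T) 0 0) -> A \in unitmx.
Proof.
move=> posA; rewrite -row_free_unit -kermx_eq0.
apply/eqP/row_matrixP => i; rewrite row0.
apply: contraPeq (posA (row i (kermx A))) => r0 /(_ r0).
by rewrite -row_mul mulmx_ker row0 mul0mx mxE ltxx.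
Qed.

(** * Christoffel symbols and the geodesic equation *)

(** Twice Gamma_{l,ij} X^i X^j, with the Christoffel symbols of the first kind:
    unlike Gamma^k_{ij} they do not involve the inverse of the metric, so they
    restrict to a coordinate slice without change. *)
Definition christoffel_low (R : realType) (m : nat) (h : 'rV[R]_m -> 'M[R]_m)
    (u X : 'rV[R]_m) (l : 'I_m) : R :=
  \sum_i \sum_j ('D_(delta_mx 0 i) (fun w => h w j l) u +
     'D_(delta_mx 0 j) (fun w => h w i l) u -
     'D_(delta_mx 0 l) (fun w => h w i j) u) * X 0 i * X 0 j.

Definition christoffel_quad (R : realType) (m : nat)
    (h : 'rV[R]_m -> 'M[R]_m) (u X : 'rV[R]_m) : 'rV[R]_m :=
  \row_k \sum_i \sum_j christoffel h u k i j * X 0 i * X 0 j.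

(** Lowering the index turns the symbols of the second kind into those of the
    first kind. *)
Lemma christoffel_quadE (R : realType) (m : nat) (h : 'rV[R]_m -> 'M[R]_m)
    (u X : 'rV[R]_m) : h u \in unitmx -> (h u)^T = h u ->
  christoffel_quad h u X =
    2^-1 *: (\row_l christoffel_low h u X l *m invmx (h u)).
Proof.
move=> hu hs; have his : (invmx (h u))^T = invmx (h u) by rewrite trmx_inv hs.
apply/rowP => k; rewrite !mxE mulr_sumr.
under eq_bigr do under eq_bigr do rewrite /christoffel mulr_sumr 2!mulr_suml.
under eq_bigr do rewrite exchange_big/=.
rewrite exchange_big/=; apply: eq_bigr => l _.
rewrite mxE mulr_suml mulr_sumr; apply: eq_bigr => i _.
rewrite mulr_suml mulr_sumr; apply: eq_bigr => j _.
rewrite -{1}his mxE; set D := (_ + _ - _).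
by ring.
Qed.

(** The row of the [christoffel_low], written with matrix products as it comes
    out of Hamilton's equations. *)
Definition christoffel_mx (R : realType) (m : nat) (h : 'rV[R]_m -> 'M[R]_m)
    (u X : 'rV[R]_m) : 'rV[R]_m :=
  \row_l (2 * (\sum_k X 0 k * (X *m 'D_(delta_mx 0 k) h u) 0 l)
          - (X *m 'D_(delta_mx 0 l) h u *m X^T) 0 0).

Lemma christoffel_mxE (R : realType) (m : nat) (h : 'rV[R]_m -> 'M[R]_m)
    (u X : 'rV[R]_m) : differentiable h u ->
  christoffel_mx h u X = \row_l christoffel_low h u X l.
Proof.
move=> dh; apply/rowP => l; rewrite !mxE /christoffel_low.
have Dh k i j : 'D_(delta_mx 0 k) (fun w => h w i j) u =
    ('D_(delta_mx 0 k) h u) i j.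
  by rewrite derive_mx ?mxE//; exact: diff_derivable.
under [in RHS]eq_bigr do under eq_bigr do rewrite !Dh.
under [in RHS]eq_bigr do under eq_bigr do rewrite !mulrDl.
under [in RHS]eq_bigr do rewrite !big_split/=.
rewrite !big_split/= mulr_natl mulr2n; congr (_ + _ + _).
- apply: eq_bigr => i _; rewrite mxE mulr_sumr; apply: eq_bigr => j _.
  by ring.
- rewrite [RHS]exchange_big/=; apply: eq_bigr => i _.
  rewrite mxE mulr_sumr; apply: eq_bigr => j _.
  by ring.
- rewrite -sumrN exchange_big/=; apply: eq_bigr => j _.
  rewrite !mxE mulr_suml -sumrN; apply: eq_bigr => i _.
  by ring.
Qed.

Section hamilton.
Context (R : realType) (d : nat) (M : manifold R d) (g : metric M)
  (c : chart R M d).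
Hypothesis ac : atlas M c.

Lemma gmx_unit u : cimg c u -> gmx g c u \in unitmx.
Proof. by move=> cu; apply: posdef_unitmx => v; exact: gmx_pos. Qed.

Lemma gmx_diff u : cimg c u -> differentiable (gmx g c) u.
Proof. by have [+ _] := gmx_smooth g ac 1; apply. Qed.

Lemma gmx_derive_continuous v u : cimg c u ->
  {for u, continuous (fun w => 'D_v (gmx g c) w)}.
Proof. by have [_ +] := gmx_smooth g ac 1; apply. Qed.

(** The tangent vector dual to the covector eta. As p is |xi|^2 and not half of
    it, the base point moves with twice this velocity. *)
Definition velocity (u : 'rV[R]_d) (eta : 'cV[R]_d) : 'rV[R]_d :=
  eta^T *m invmx (gmx g c u).

(** The time derivative of [velocity] along the flow ([velocity_derive]). *)
Definition acceleration (u : 'rV[R]_d) (eta : 'cV[R]_d) : 'rV[R]_d :=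
  - (christoffel_mx (gmx g c) u (velocity u eta) *m invmx (gmx g c u)).

Lemma invmx_gmx_sym u : cimg c u ->
  (invmx (gmx g c u))^T = invmx (gmx g c u).
Proof. by move=> cu; rewrite trmx_inv gmx_sym. Qed.

Lemma ham_xE u eta : cimg c u -> ham_x g c u eta = 2 *: velocity u eta.
Proof.
move=> cu; apply/rowP => i; rewrite !mxE.
set A := invmx (gmx g c u).
have dsymb : is_derive eta (delta_mx i 0 : 'cV[R]_d)
    (fun e : 'cV[R]_d => e^T *m A *m e)
    (((delta_mx i 0)^T *m A + eta^T *m 0) *m eta + eta^T *m A *m delta_mx i 0).
  have dtr := is_derive_trmx (is_derive_id eta (delta_mx i 0 : 'cV[R]_d)).
  apply: is_derive_mulmx (is_derive_id _ _).
  exact: is_derive_mulmx dtr (is_derive_cst _ _ _).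
have [_ ->] := @is_derive_mxE R _ 1 1 _ _ _ _ 0 0 dsymb.
rewrite mulmx0 addr0 mxE mulr_natl mulr2n; congr (_ + _).
  transitivity (((delta_mx i 0 : 'cV[R]_d)^T *m A *m eta)^T 0 0).
    by rewrite [RHS]mxE.
  by rewrite !trmx_mul trmxK /A invmx_gmx_sym// mulmxA -colE 2!mxE.
by rewrite -colE 2!mxE.
Qed.

Lemma velocityT u eta : cimg c u ->
  (velocity u eta)^T = invmx (gmx g c u) *m eta.
Proof. by move=> cu; rewrite /velocity trmx_mul trmxK invmx_gmx_sym. Qed.

Lemma ham_xiE u eta : cimg c u -> ham_xi g c u eta =
  \col_i (velocity u eta *m 'D_(delta_mx 0 i) (gmx g c) u
           *m (velocity u eta)^T) 0 0.
Proof.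
move=> cu; apply/colP => i; rewrite [LHS]mxE [RHS]mxE velocityT// /velocity.
set A := invmx (gmx g c u); set D := 'D_(_) (gmx g c) u.
have dG : is_derive u (delta_mx 0 i : 'rV[R]_d) (gmx g c) D.
  by split=> //; exact/diff_derivable/gmx_diff.
have dsymb : is_derive u (delta_mx 0 i : 'rV[R]_d)
    (fun w => eta^T *m invmx (gmx g c w) *m eta)
    ((0 *m A + eta^T *m (- (A *m D *m A))) *m eta + eta^T *m A *m 0).
  apply: is_derive_mulmx (is_derive_cst _ _ _).
  apply: is_derive_mulmx (is_derive_cst _ _ _) _.
  exact: is_derive_invmx (gmx_unit cu) dG.
have [_ ->] := @is_derive_mxE R _ 1 1 _ _ _ _ 0 0 dsymb.
rewrite mulmx0 mul0mx addr0 add0r mulmxN mulNmx.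
by rewrite [X in - X = _]mxE opprK !mulmxA.
Qed.

(** Differentiating v G = xi^T along the flow gives
    (dv/dt) G = (d xi/dt)^T - v dG/dt, where the first term is v (d_l G) v^T by
    the second Hamilton equation and dG/dt = 2 sum_k v_k d_k G by the first. *)
Lemma velocity_derive (u : R -> 'rV[R]_d) (eta : R -> 'cV[R]_d) t :
  cimg c (u t) ->
  is_derive t (1 : R) u (ham_x g c (u t) (eta t)) ->
  is_derive t (1 : R) eta (ham_xi g c (u t) (eta t)) ->
  is_derive t (1 : R) (fun s => velocity (u s) (eta s))
    (acceleration (u t) (eta t)).
Proof.
move=> cu du deta.
have dG := is_derive_comp (gmx_diff cu) du.
have dinv := @is_derive_invmx _ _ _ (gmx g c \o u) _ _ _ (gmx_unit cu) dG.
apply: is_derive_eq; first exact: is_derive_mulmx (is_derive_trmx deta) dinv.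
rewrite mulmxN !mulmxA -mulmxBl -/(velocity _ _) /acceleration -[RHS]mulNmx /=.
congr (_ *m _); rewrite ham_xiE// ham_xE//; set v := velocity _ _.
rewrite derive_coord_sum; last exact: gmx_diff.
rewrite mulmx_sumr; apply/rowP => l; rewrite !mxE opprB; congr (_ - _).
rewrite summxE mulr_sumr; apply: eq_bigr => k _.
by rewrite -scalemxAr !mxE mulrA.
Qed.

(** The geodesic equation, for v equal to half the derivative of x. *)
Lemma accelerationE u eta : cimg c u ->
  acceleration u eta = - 2 *: christoffel_quad (gmx g c) u (velocity u eta).
Proof.
move=> cu; rewrite christoffel_quadE ?gmx_unit ?gmx_sym//.
rewrite scalerA mulNr divff// scaleN1r /acceleration christoffel_mxE//.
exact: gmx_diff.
Qed.

Lemma cvg_velocity (T : Type) (F : set_system T) {FF : Filter F}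
    (f : T -> 'rV[R]_d) (h : T -> 'cV[R]_d) (u : 'rV[R]_d) (eta : 'cV[R]_d) :
  cimg c u ->
  f @ F --> u -> h @ F --> eta ->
  velocity (f x) (h x) @[x --> F] --> velocity u eta.
Proof.
move=> cu fu heta; apply: cvg_mulmx; first exact: cvg_trmx.
apply: cvg_invmx; first exact: gmx_unit.
apply: cvg_comp fu _.
exact: differentiable_continuous (gmx_diff cu).
Qed.

Lemma cvg_acceleration (T : Type) (F : set_system T) {FF : Filter F}
    (f : T -> 'rV[R]_d) (h : T -> 'cV[R]_d) (u : 'rV[R]_d) (eta : 'cV[R]_d) :
  cimg c u ->
  f @ F --> u -> h @ F --> eta ->
  acceleration (f x) (h x) @[x --> F] --> acceleration u eta.
Proof.
move=> cu fu heta; apply: cvgN.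
have vcvg : velocity (f x) (h x) @[x --> F] --> velocity u eta.
  exact: cvg_velocity.
have Dcvg k : 'D_(delta_mx 0 k) (gmx g c) (f x) @[x --> F] -->
    'D_(delta_mx 0 k) (gmx g c) u.
  exact: (@cvg_comp _ _ _ f (fun w => 'D_(delta_mx 0 k) (gmx g c) w) _ _ _ fu
    (gmx_derive_continuous cu)).
apply: cvg_mulmx.
  apply: cvg_mx => i l; rewrite mxE.
  under eq_cvg do rewrite mxE.
  apply: cvgB.
    apply: cvgMl_tmp; apply: cvg_sum => k _; apply: cvgM.
      exact: (cvg_mxE vcvg).
    exact: (cvg_mxE (cvg_mulmx vcvg (Dcvg k))).
  exact: (cvg_mxE
    (cvg_mulmx (cvg_mulmx vcvg (Dcvg l)) (cvg_trmx vcvg))).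
apply: cvg_invmx; first exact: gmx_unit.
apply: cvg_comp fu _.
exact: differentiable_continuous (gmx_diff cu).
Qed.

End hamilton.

(** * The second fundamental form in a slice chart *)

Lemma slice_incl_max (R : realType) (n : nat) (y : 'rV[R]_n) :
  slice_incl y 0 ord_max = 0.
Proof. by rewrite mxE unlift_none. Qed.

Lemma slice_incl_lift (R : realType) (n : nat) (y : 'rV[R]_n) (i : 'I_n) :
  slice_incl y 0 (lift ord_max i) = y 0 i.
Proof. by rewrite mxE liftK. Qed.

Lemma slice_inclP (R : realType) (n : nat) (u : 'rV[R]_n.+1) :
  u 0 ord_max = 0 -> exists y, u = slice_incl y.
Proof.
move=> u0; exists (\row_i u 0 (lift ord_max i)).
apply/rowP => j; case: (unliftP ord_max j) => [i|] ->.
  by rewrite slice_incl_lift mxE.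
by rewrite slice_incl_max.
Qed.

Lemma slice_incl_linear (R : realType) (n : nat) :
  linear (@slice_incl R n).
Proof.
move=> a x y; apply/rowP => j; rewrite !mxE.
by case: unlift => [i|]; rewrite ?mxE// mulr0 addr0.
Qed.

HB.instance Definition _ (R : realType) (n : nat) :=
  GRing.isLinear.Build R 'rV[R]_n 'rV[R]_n.+1 _ (@slice_incl R n)
    (@slice_incl_linear R n).

Lemma slice_incl_delta (R : realType) (n : nat) (i : 'I_n) :
  slice_incl (delta_mx 0 i : 'rV[R]_n) = delta_mx 0 (lift ord_max i).
Proof.
apply/rowP => j; case: (unliftP ord_max j) => [k|] ->.
  by rewrite slice_incl_lift !mxE (inj_eq lift_inj).
by rewrite slice_incl_max mxE (negPf (neq_lift _ _)) andbF.
Qed.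

Lemma sum_slice_incl (R : realType) (n : nat) (X : 'rV[R]_n)
    (F : 'I_n.+1 -> R) :
  \sum_i F i * slice_incl X 0 i = \sum_i F (lift ord_max i) * X 0 i.
Proof.
rewrite (bigD1_ord ord_max)//= slice_incl_max mulr0 add0r.
by apply: eq_bigr => i _; rewrite slice_incl_lift.
Qed.

Section second_fundamental_form.
Context (R : realType) (n : nat) (M : manifold R n.+1) (g : metric M)
  (c : chart R M n.+1) (y : 'rV[R]_n).
Hypotheses (ac : atlas M c) (cy : cimg c (slice_incl y)).

Lemma slice_incl_quad (X Y : 'rV[R]_n) (A : 'M[R]_n.+1) :
  (slice_incl X *m A *m (slice_incl Y)^T) 0 0 =
  (X *m (\matrix_(i, j) A (lift ord_max i) (lift ord_max j)) *m Y^T) 0 0.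
Proof.
rewrite !mxE; under eq_bigr do rewrite [_^T _ _]mxE.
rewrite sum_slice_incl; apply: eq_bigr => j _.
rewrite [Y^T _ _]mxE; congr (_ * _); rewrite !mxE.
under eq_bigr do rewrite mulrC.
rewrite sum_slice_incl; apply: eq_bigr => i _.
by rewrite mxE mulrC.
Qed.

Lemma induced_pos (v : 'rV[R]_n) : v != 0 ->
  0 < (v *m Defs.induced g c y *m v^T) 0 0.
Proof.
move=> v0; rewrite /Defs.induced -slice_incl_quad; apply: gmx_pos => //.
apply: contra_neq v0 => iv0; apply/rowP => i.
by rewrite -slice_incl_lift iv0 !mxE.
Qed.

Lemma induced_sym : (Defs.induced g c y)^T = Defs.induced g c y.
Proof.
apply/matrixP => i j; rewrite !mxE.
by rewrite -[in RHS](gmx_sym g ac cy) mxE.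
Qed.

Lemma induced_derive i j k :
  'D_(delta_mx 0 k) (fun w => Defs.induced g c w i j) y =
  'D_(delta_mx 0 (lift ord_max k))
     (fun w => gmx g c w (lift ord_max i) (lift ord_max j)) (slice_incl y).
Proof.
rewrite -slice_incl_delta /derive.
by under [X in lim (X @ _)]funext => h do rewrite /= !mxE linearP/=.
Qed.

(** The symbols of the first kind with tangential indices only differentiate
    tangential entries of the metric, and in tangential directions. *)
Lemma christoffel_low_induced (X : 'rV[R]_n) l :
  christoffel_low (gmx g c) (slice_incl y) (slice_incl X) (lift ord_max l) =
  christoffel_low (Defs.induced g c) y X l.
Proof.
rewrite /christoffel_low.
under eq_bigr do rewrite sum_slice_incl.
rewrite exchange_big/= [RHS]exchange_big/=; apply: eq_bigr => j _.
under eq_bigr do rewrite mulrAC.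
rewrite sum_slice_incl; apply: eq_bigr => i _.
by rewrite !induced_derive mulrAC.
Qed.

Lemma covariant_cst m (h : 'rV[R]_m -> 'M[R]_m) (u X : 'rV[R]_m) :
  covariant h (fun=> X) (fun=> X) u = christoffel_quad h u X.
Proof. by rewrite /covariant derive_cst add0r. Qed.

(** Both covariant derivatives have the same products with the tangential
    coordinate fields, since the symbols of the first kind agree. *)
Lemma second_ff_normal (X : 'rV[R]_n) l :
  (second_ff g c y X X *m gmx g c (slice_incl y)) 0 (lift ord_max l) = 0.
Proof.
rewrite /second_ff !covariant_cst mulmxBl mxE [X in _ + X]mxE.
apply/eqP; rewrite subr_eq0; apply/eqP.
have uG := gmx_unit g ac cy.
have uh := posdef_unitmx induced_pos.
rewrite christoffel_quadE ?gmx_sym// -scalemxAl mulmxKV// !mxE.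
under eq_bigr do rewrite mulrC.
rewrite sum_slice_incl.
transitivity
  ((christoffel_quad (Defs.induced g c) y X *m Defs.induced g c y) 0 l).
  rewrite christoffel_quadE ?induced_sym// -scalemxAl mulmxKV// !mxE.
  by rewrite christoffel_low_induced.
rewrite mxE; apply: eq_bigr => i _.
by rewrite [Defs.induced _ _ _ _ _]mxE mulrC.
Qed.

(** If the n-th component of w = II(X, X) vanishes then w is tangent to H; being
    also normal, it satisfies w G w^T = 0. *)
Lemma second_ff_eq0 (X : 'rV[R]_n) :
  christoffel_quad (gmx g c) (slice_incl y) (slice_incl X) 0 ord_max = 0 ->
  second_ff g c y X X = 0.
Proof.
move=> quad0; have [z wz] : exists z, second_ff g c y X X = slice_incl z.
  apply: slice_inclP.
  by rewrite /second_ff !covariant_cst mxE [X in _ + X]mxE slice_incl_max subr0.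
apply: contra_eq (erefl (0 : R)) => w0.
have := gmx_pos g ac cy w0.
rewrite mxE wz; under eq_bigr do rewrite [_^T _ _]mxE.
rewrite sum_slice_incl big1 ?ltxx// => l _.
by rewrite -wz second_ff_normal mul0r.
Qed.

End second_fundamental_form.

(** * Transverse zeros along the orbits of a measure-preserving flow *)

Section transverse_zeros.
Context (R : realType) (T : ptopologicalType) (phi : R -> T -> T).
Let borelT := g_sigma_algebraType (@open T).
Context (mu : probability borelT R).

Hypothesis phi_continuous : continuous (fun z : R * T => phi z.1 z.2).
Hypothesis phi0 : forall x, phi 0 x = x.
Hypothesis phiD : forall s t x, phi (s + t) x = phi s (phi t x).
Hypothesis phi_mu : forall t (A : set borelT), measurable A ->
  mu (phi t @^-1` A) = mu A.

Lemma open_borel (A : set T) : open A -> measurable (A : set borelT).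
Proof. exact: sub_sigma_algebra. Qed.

Lemma phi_continuous_point t : continuous (phi t).
Proof.
move=> x; have tx : (t, y) @[y --> x] --> (t, x).
  exact: (@cvg_pair _ _ _ (nbhs x) (nbhs t) (nbhs x) _ _ _ (cst t) id
    (cvg_cst _) cvg_id).
exact: (@cvg_comp _ _ _ (fun y => (t, y)) (fun z => phi z.1 z.2) _ _ _ tx
  (@phi_continuous (t, x))).
Qed.

Lemma phi_continuous_time x : continuous (fun t => phi t x).
Proof.
move=> t; have tx : (s, x) @[s --> t] --> (t, x).
  exact: (@cvg_pair _ _ _ (nbhs t) (nbhs t) (nbhs x) _ _ _ id (cst x)
    cvg_id (cvg_cst _)).
exact: (@cvg_comp _ _ _ (fun s => (s, x)) (fun z => phi z.1 z.2) _ _ _ tx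
  (@phi_continuous (t, x))).
Qed.

Lemma phi_measurable t (A : set borelT) : measurable A ->
  measurable (phi t @^-1` A : set borelT).
Proof.
have mphi : measurable_fun setT (phi t : borelT -> borelT).
  apply: (@measurability _ _ borelT borelT setT (phi t) (@open T)) => //.
  move=> _ [B oB <-].
  rewrite setTI; apply: open_borel.
  by have /continuousP := @phi_continuous_point t; apply.
by move=> mA; have := mphi measurableT _ mA; rewrite setTI.
Qed.

Definition stays (V : set T) (e : R) : set T :=
  [set x | forall t, 0 <= t <= e -> V (phi t x)].

(** The tube lemma over the compact time interval [0, e]. *)
Lemma open_stays V e : open V -> open (stays V e).
Proof.
move=> oV; rewrite openE => x Vx.
have /compact_near_coveringP/(_ _ (nbhs x) (fun y t => V (phi t y)) _) :=
  @segment_compact R 0 e.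
have near_t t : `[0, e]%classic t ->
    \forall t' \near t & y \near nbhs x, V (phi t' y).
  rewrite /= in_itv/= => /Vx Vt.
  by apply: (@phi_continuous (t, x)); exact: open_nbhs_nbhs.
move=> /(_ near_t); apply: filterS => y Vy t te.
by apply: Vy; rewrite /= in_itv.
Qed.

(** The preimages of E at the times e, e/2, e/3, ... are disjoint and have equal
    mass, so N times that mass is at most 1 for every N. *)
Lemma disjoint_translates_null (E : set borelT) (e : R) :
  measurable E -> 0 < e ->
  (forall x s t, 0 <= s -> s < t -> t <= e -> E (phi s x) -> E (phi t x) ->
    False) ->
  mu E = 0%E.
Proof.
move=> mE e0 disj.
pose tau (k : nat) : R := e / k.+1%:R.
have tau_gt0 k : 0 < tau k by rewrite divr_gt0.
have tau_le k : tau k <= e.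
  by rewrite ler_pdivrMr// ler_peMr ?ler1n// ltW.
have tau_lt i j : (i < j)%N -> tau j < tau i.
  by move=> ij; rewrite ltr_pM2l// ltf_pV2 ?posrE// ltr_nat.
have tE : trivIset setT (fun k => phi (tau k) @^-1` E).
  apply/trivIsetP => i j _ _; rewrite neq_lt => /orP ij.
  apply/seteqP; split=> // x [Ei Ej].
  case: ij => /tau_lt ij.
    exact: (disj x (tau j) (tau i) (ltW (tau_gt0 j)) ij (tau_le i)).
  exact: (disj x (tau i) (tau j) (ltW (tau_gt0 i)) ij (tau_le j)).
have le1 N : (\sum_(k < N) mu E <= 1)%E.
  have mB k : measurable (phi (tau k) @^-1` E : set borelT).
    exact: phi_measurable.
  have -> : (\sum_(k < N) mu E =
      mu (\big[setU/set0]_(k < N) (phi (tau k) @^-1` E)))%E.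
    rewrite (@measure_bigsetU _ _ _ mu (fun k => phi (tau k) @^-1` E) mB tE).
    by apply: eq_bigr => k _; exact/esym/phi_mu.
  by apply: probability_le1; exact: bigsetU_measurable.
have Efin : mu E \is a fin_num by exact: fin_num_measure.
apply/eqP; rewrite -(fineK Efin) eqe; apply/negPn/negP => r_neq0.
have r0 : 0 < fine (mu E) by rewrite lt_def r_neq0 fine_ge0.
have := le1 (Num.truncn (fine (mu E))^-1).+1.
rewrite -(fineK Efin) sumEFin sumr_const card_ord lee_fin leNgt => /negP; apply.
rewrite -mulr_natr -ltr_pdivrMl// mulr1.
by rewrite -truncn_le_nat.
Qed.

Variables (V : set T) (F F' : T -> R).
Hypothesis V_open : open V.
Hypothesis F'_neq0 : forall x, V x -> F' x != 0.
Hypothesis F_derive : forall x t, V (phi t x) ->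
  is_derive t (1 : R) (fun s => F (phi s x)) (F' (phi t x)).

(** Rolle's theorem: between two zeros of F on the orbit F' would vanish. *)
Lemma stays_zero_once x s t e : s < t -> t - s <= e ->
  stays V e (phi s x) -> F (phi s x) = 0 -> F (phi t x) = 0 -> False.
Proof.
move=> st tse Vs Fs Ft.
have Vr r : r \in `[s, t] -> V (phi r x).
  rewrite in_itv/= => /andP[sr rt].
  have := Vs (r - s); rewrite -phiD subrK; apply.
  by rewrite subr_ge0 sr/= (le_trans _ tse)// lerD2r.
have dF r : r \in `[s, t] -> derivable (fun q => F (phi q x)) r 1.
  by move=> /Vr/F_derive[].
have [r rst [_]] := Rolle st (fun r rst => dF r (subset_itv_oo_cc rst))
  (derivable_within_continuous dF) (etrans Fs (esym Ft)).
have Vphi := Vr _ (subset_itv_oo_cc rst).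
have [_ ->] := F_derive Vphi.
by apply/eqP; exact: F'_neq0.
Qed.

(** As V is open, every point of V stays in V for some time 1/(k+1), so the
    zeros split into countably many sets on which the return time is bounded
    below. *)
Lemma transverse_zeros_null :
  measurable (V `&` [set x | F x = 0] : set borelT) ->
  mu.-negligible (V `&` [set x | F x = 0] : set borelT).
Proof.
set Z := _ `&` _ => mZ.
pose E k : set borelT := Z `&` stays V k.+1%:R^-1.
have -> : Z = \bigcup_k E k.
  apply/seteqP; split=> [x Zx|x [k _ []]//].
  have : \forall t \near (0 : R), V (phi t x).
    apply: (@phi_continuous_time x 0); rewrite phi0.
    by apply: open_nbhs_nbhs; split=> //; case: Zx.
  move=> /nbhs_ballP[e /= e0 Ve].
  have [k _ ke] := near_infty_natSinv_lt (PosNum e0).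
  exists k => //; split=> // t /andP[t0 tk]; apply: Ve.
  rewrite /ball/= sub0r normrN ger0_norm//.
  by apply: le_lt_trans tk _; apply: ke => /=.
apply: negligible_bigcup => k.
have mE : measurable (E k : set borelT).
  have mS := open_borel (open_stays k.+1%:R^-1 V_open).
  exact: (@measurableI _ borelT _ _ mZ mS).
apply/negligibleP => //; apply: (@disjoint_translates_null _ k.+1%:R^-1) => //.
move=> x s t s0 st tk [[_ Fs] Vs] [[_ Ft] _].
by apply: (stays_zero_once st _ Vs Fs Ft); rewrite lerBlDr ler_wpDr.
Qed.

End transverse_zeros.

(** * Canonical coordinates on the cosphere bundle *)

(** The rows of the Jacobian matrix are the partial derivatives. *)
Lemma jacobian_continuous (R : realType) (m n : nat)
    (f : 'rV[R]_m -> 'rV[R]_n) (U : set 'rV[R]_m) u :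
  open U -> smooth_on U f -> U u -> {for u, continuous (jacobian f)}.
Proof.
move=> oU sf Uu; have [df Dcont] := sf 1.
have rowD w i : U w -> row i (jacobian f w) = 'D_(delta_mx 0 i) f w.
  by move=> Uw; rewrite deriveEjacobian ?rowE//; exact: df.
apply: (@cvg_mx _ _ (nbhs u)) => i j.
have jE w : U w -> jacobian f w i j = ('D_(delta_mx 0 i) f w) 0 j.
  by move=> Uw; rewrite -rowD// [RHS]mxE.
have Dc : 'D_(delta_mx 0 i) f w @[w --> u] --> 'D_(delta_mx 0 i) f u.
  exact: Dcont.
have Dij : ('D_(delta_mx 0 i) f w) 0 j @[w --> u] --> jacobian f u i j.
  by rewrite (jE u Uu); exact: (cvg_mxE Dc).
apply: cvg_trans Dij; apply: near_eq_cvg; near=> w.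
by rewrite (jE w)//; near: w; exact: open_nbhs_nbhs.
Unshelve. all: by end_near. Qed.

Section cosphere_coordinates.
Context (R : realType) (d : nat) (M : manifold R d) (g : metric M).

Lemma chart_image_open (c : chart R M d) (V : set M) :
  open V -> open (cmap c @` (cdom c `&` V)).
Proof.
move=> oV; rewrite openE => _ [x [cx Vx] <-].
have cux : (cmap c @` cdom c) (cmap c x) by exists x.
have nV : \forall w \near cmap c x, V (cinv c w).
  apply: (cinv_continuous cux); rewrite cmapK//; exact: open_nbhs_nbhs.
have nc : \forall w \near cmap c x, (cmap c @` cdom c) w.
  by apply: open_nbhs_nbhs; split=> //; exact: cimg_open.
near=> w.
have [x' cx' x'w] : (cmap c @` cdom c) w by near: w.
have : V (cinv c w) by near: w.
by rewrite -x'w cmapK// => Vx'; exists x'.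
Unshelve. all: by end_near. Qed.

(** Openness in S^*M is tested in every chart c', where the set becomes the
    preimage of W under the change of canonical coordinates from c' to c; that
    map is continuous because the transition maps are C^1. *)
Lemma open_ccoord (c : chart R M d) (W : set ('rV[R]_d * 'cV[R]_d)) :
  atlas M c -> open W ->
  open [set rho : cosphere g | cdom c (base rho) /\ W (ccoord c rho)].
Proof.
move=> ac oW; rewrite -[open _]/(cosphere_open _) => c' ac'.
pose D := cmap c' @` (cdom c' `&` cdom c).
pose D' := cmap c @` (cdom c `&` cdom c').
have oD : open D by apply/chart_image_open/cdom_open.
have oD' : open D' by apply/chart_image_open/cdom_open.
pose change (z : 'rV[R]_d * 'cV[R]_d) : 'rV[R]_d * 'cV[R]_d :=
  (transition c' c z.1,
   jacobian (transition c c') (transition c' c z.1) *m z.2).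
exists [set z | D z.1 /\ W (change z)].
  rewrite openE => z [Dz Wz].
  have tcont : {for z.1, continuous (transition c' c)}.
    by have := atlas_smooth ac' ac 0; apply.
  have D't : D' (transition c' c z.1).
    case: Dz => x [cx' cx] <-; exists x => //.
    by rewrite /transition/= cmapK.
  have jcont := jacobian_continuous oD' (atlas_smooth ac ac') D't.
  have t1 : transition c' c w.1 @[w --> z] --> transition c' c z.1.
    have f1 : w.1 @[w --> z] --> z.1 by exact: cvg_fst.
    exact: (@cvg_comp _ _ _ fst (transition c' c) _ _ _ f1 tcont).
  have j1 : jacobian (transition c c') (transition c' c w.1) @[w --> z] -->
      jacobian (transition c c') (transition c' c z.1).
    exact: (@cvg_comp _ _ _ (fun w => transition c' c w.1)
      (jacobian (transition c c')) _ _ _ t1 jcont).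
  have chcont : change w @[w --> z] --> change z.
    have s1 : w.2 @[w --> z] --> z.2 by exact: cvg_snd.
    exact: (cvg_pair t1 (cvg_mulmx j1 s1)).
  have nW : \forall w \near z, W (change w).
    by apply: chcont; exact: open_nbhs_nbhs.
  have nD : \forall w \near z, D w.1.
    by apply: (@cvg_fst _ _ (nbhs z.1) (nbhs z.2)); exact: open_nbhs_nbhs.
  by near=> w; split; near: w.
move=> rho c'r; split=> [[cr Wr]|[[x [c'x cx] xr] Wr]].
  split=> /=; first by exists (base rho).
  suff -> : change (ccoord c' rho) = ccoord c rho by [].
  rewrite /change /ccoord/= /transition/= cmapK//; congr pair.
  by rewrite -comp_change.
have xE : x = base rho by rewrite -(cmapK c'x) xr cmapK.
have cr : cdom c (base rho) by rewrite -xE.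
split=> //; suff <- : change (ccoord c' rho) = ccoord c rho by [].
rewrite /change /ccoord/= /transition/= cmapK//; congr pair.
by rewrite -comp_change.
Unshelve. all: by end_near. Qed.

End cosphere_coordinates.

(** Lindelof's property, with the chosen cover enumerated by nat; None stands
    for the numbers that code no basic open set contained in some D i. *)
Lemma second_countable_cover (T : topologicalType) (I : Type) (P : set I)
    (D : I -> set T) : @second_countable T -> (forall i, P i -> open (D i)) ->
  exists f : nat -> option I,
    (forall k i, f k = Some i -> P i) /\
    forall x i, P i -> D i x -> exists k j, f k = Some j /\ D j x.
Proof.
move=> [B cB [Bo Bbasis]] oD.
have /countable_injP[code codeI] := cB.
pose Q k i := P i /\ exists b, [/\ B b, code b = k & b `<=` D i].
pose f k := if pselect (exists i, Q k i) is left e then Some (sval (cid e))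
            else None.
exists f; split=> [k i|x i Pi Dx].
  by rewrite /f; case: pselect => // e [<-]; case: cid => j /= [].
have [b [Bb bx] bD] : filter_from [set U | B U /\ U x] id (D i).
  by apply: Bbasis; apply: open_nbhs_nbhs; split=> //; exact: oD.
have eQ : exists i, Q (code b) i by exists i; split=> //; exists b.
exists (code b); rewrite /f; case: pselect => // e.
exists (sval (cid e)); split=> //; case: cid => j /= [_ [b' [Bb' cbb' bD']]].
by apply: bD'; rewrite (codeI b' b)// ?inE.
Qed.

(** * The cosphere bundle over a hypersurface *)

Section slice.
Context (R : realType) (n : nat) (M : manifold R n.+1) (g : metric M)
  (H : set M) (rho0 : cosphere g) (phi : R -> cosphere g -> cosphere g)
  (mu : probability (borel_cosphere rho0) R).
Hypothesis phi_flow : geodesic_flow phi.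
Hypothesis phi_mu : flow_invariant phi mu.
Context (c : chart R M n.+1).
Hypothesis Hc : slice_chart H c.
Let ac : atlas M c := Hc.1.

Local Notation coords := ('rV[R]_n.+1 * 'cV[R]_n.+1)%type.

Lemma open_nonzero (W : set coords) (K : coords -> R) :
  open W -> (forall z, W z -> {for z, continuous K}) ->
  open (W `&` [set z | K z != 0]).
Proof.
move=> oW Kc; rewrite openE => z [Wz Kz].
have nK : \forall w \near z, K w != 0.
  exact: (@cvgr_neq0 R R _ (nbhs z) _ K (K z) (Kc z Wz) Kz).
have nW : \forall w \near z, W w by exact: open_nbhs_nbhs.
by near=> w; split; near: w.
Unshelve. all: by end_near. Qed.

(** A set of zeros that is closed relatively to an open set: a difference of two
    open sets. *)
Lemma zeros_measurable (W : set coords) (K : coords -> R) :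
  open W -> (forall z, W z -> {for z, continuous K}) ->
  measurable ([set rho : cosphere g | cdom c (base rho) /\ W (ccoord c rho)]
    `&` [set rho | K (ccoord c rho) = 0] : set (borel_cosphere rho0)).
Proof.
move=> oW Kc; set A := [set _ | _].
pose B := [set rho : cosphere g | cdom c (base rho) /\
  (W `&` [set z | K z != 0]) (ccoord c rho)].
have mA : measurable (A : set (borel_cosphere rho0)).
  by apply: sub_sigma_algebra; exact: open_ccoord.
have mB : measurable (B : set (borel_cosphere rho0)).
  by apply: sub_sigma_algebra; apply: open_ccoord => //; exact: open_nonzero.
have -> : A `&` [set rho | K (ccoord c rho) = 0] = A `\` B.
  apply/seteqP; split=> rho [[cr Wr] Kr]; split=> //=.
    by move=> [_ [_ /eqP]].
  by apply/eqP/negPn/negP => K0; apply: Kr; split.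
exact: (@measurableD _ (borel_cosphere rho0)).
Qed.

Lemma transverse_coord_null (W : set coords) (K K' : coords -> R) :
  open W -> W `<=` [set z | cimg c z.1] ->
  (forall z, W z -> {for z, continuous K}) ->
  (forall z, W z -> K' z != 0) ->
  (forall rho t, cdom c (base (phi t rho)) ->
    is_derive t (1 : R) (fun s => K (ccoord c (phi s rho)))
      (K' (ccoord c (phi t rho)))) ->
  mu.-negligible
    ([set rho : cosphere g | cdom c (base rho) /\ W (ccoord c rho)]
      `&` [set rho | K (ccoord c rho) = 0] : set (borel_cosphere rho0)).
Proof.
move=> oW Wc Kc K'0 dK; have [pc p0 pD _] := phi_flow.
apply: (@transverse_zeros_null R (pcosphere rho0) phi mu pc p0 pD phi_mu
  [set rho : cosphere g | cdom c (base rho) /\ W (ccoord c rho)]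
  (K \o ccoord c) (K' \o ccoord c)).
- exact: open_ccoord.
- by move=> rho [_ /K'0].
- by move=> rho t [cr _]; exact: dK.
- exact: zeros_measurable.
Qed.

Let height (z : coords) : R := z.1 0 ord_max.
Let speed (z : coords) : R := 2 * velocity g c z.1 z.2 0 ord_max.
Let accel (z : coords) : R := 2 * acceleration g c z.1 z.2 0 ord_max.

Let cimg_opens : open [set z : coords | cimg c z.1].
Proof.
rewrite openE => z cz; apply: (@cvg_fst _ _ (nbhs z.1) (nbhs z.2)).
by apply: open_nbhs_nbhs; split=> //; exact: cimg_open.
Qed.

Let height_continuous z : {for z, continuous height}.
Proof. by apply: cvg_mxE; exact: cvg_fst. Qed.

Let speed_continuous z : cimg c z.1 -> {for z, continuous speed}.
Proof.
move=> cz; apply: cvgMl_tmp; apply: cvg_mxE.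
by apply: cvg_velocity => //; [exact: cvg_fst | exact: cvg_snd].
Qed.

Let accel_continuous z : cimg c z.1 -> {for z, continuous accel}.
Proof.
move=> cz; apply: cvgMl_tmp; apply: cvg_mxE.
by apply: cvg_acceleration => //; [exact: cvg_fst | exact: cvg_snd].
Qed.

Let height_derive rho t : cdom c (base (phi t rho)) ->
  is_derive t (1 : R) (fun s => height (ccoord c (phi s rho)))
    (speed (ccoord c (phi t rho))).
Proof.
move=> cr; have [_ _ _ /(_ rho t c ac cr)[du _]] := phi_flow.
have cu : cimg c (cmap c (base (phi t rho))) by exists (base (phi t rho)).
have := @is_derive_mxE R _ 1 n.+1 _ _ _ _ 0 ord_max du.
by rewrite ham_xE// mxE.
Qed.

Let speed_derive rho t : cdom c (base (phi t rho)) ->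
  is_derive t (1 : R) (fun s => speed (ccoord c (phi s rho)))
    (accel (ccoord c (phi t rho))).
Proof.
move=> cr; have [_ _ _ /(_ rho t c ac cr)[du deta]] := phi_flow.
have cu : cimg c (cmap c (base (phi t rho))) by exists (base (phi t rho)).
have dv := @velocity_derive R n.+1 M g c ac _ _ t cu du deta.
exact: (is_deriveZ 2 (@is_derive_mxE R _ 1 n.+1 _ _ _ _ 0 ord_max dv)).
Qed.

(** This is where non-degeneracy enters: if x_n, v_n and dv_n/dt all vanish,
    then II(v, v) = 0, so v = 0 and the covector is not a unit covector. *)
Lemma transverse_or_curved (rho : cosphere g) :
  second_ff_nondegenerate g H -> cdom c (base rho) ->
  height (ccoord c rho) = 0 -> speed (ccoord c rho) = 0 ->
  accel (ccoord c rho) != 0.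
Proof.
move=> nondeg cr h0 s0; apply/eqP => a0.
have cu : cimg c (cmap c (base rho)) by exists (base rho).
have [y yE] : exists y, cmap c (base rho) = slice_incl y := slice_inclP h0.
have v0 : velocity g c (cmap c (base rho)) (Defs.comp rho c) 0 ord_max = 0.
  by move/eqP: s0; rewrite mulf_eq0 pnatr_eq0/= => /eqP.
have [X XE] := slice_inclP v0.
have quad0 : christoffel_quad (gmx g c) (slice_incl y) (slice_incl X) 0 ord_max
    = 0.
  rewrite -yE -XE; move/eqP: a0; rewrite /accel accelerationE// mxE.
  by rewrite !mulf_eq0 oppr_eq0 pnatr_eq0/= => /eqP.
rewrite yE in cu.
have X0 := nondeg c Hc y cu X (second_ff_eq0 ac cu quad0).
have := cvec_unit ac cr.
rewrite /symb -/(velocity g c _ _) XE X0.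
rewrite (_ : slice_incl 0 = 0) ?mul0mx ?mxE; last exact: linear0.
by move/eqP; rewrite eq_sym oner_eq0.
Qed.

Lemma slice_measurable :
  measurable ([set rho : cosphere g | cdom c (base rho) /\ H (base rho)]
    : set (borel_cosphere rho0)).
Proof.
have := @zeros_measurable setT height openT (fun z _ => @height_continuous z).
congr (measurable _); apply/seteqP; split=> rho /=.
  by move=> [[cr _] h0]; split=> //; apply/(Hc.2 _ cr).
by move=> [cr /(Hc.2 _ cr)].
Qed.

(** The two pairs (F, F') are (height, speed) and (speed, accel). *)
Lemma slice_negligible : second_ff_nondegenerate g H ->
  mu.-negligible ([set rho : cosphere g | cdom c (base rho) /\ H (base rho)]
    : set (borel_cosphere rho0)).
Proof.
move=> nondeg.
have N1 := transverse_coord_null (open_nonzero cimg_opens speed_continuous)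
  (@subIsetl _ _ _) (fun z _ => @height_continuous z) (fun z Wz => Wz.2)
  height_derive.
have N2 := transverse_coord_null (open_nonzero cimg_opens accel_continuous)
  (@subIsetl _ _ _) (fun z Wz => speed_continuous Wz.1) (fun z Wz => Wz.2)
  speed_derive.
apply: negligibleS (negligibleU N1 N2) => rho [cr Hr].
have h0 : height (ccoord c rho) = 0 by apply/(Hc.2 _ cr).
have cu : cimg c (cmap c (base rho)) by exists (base rho).
have [s0|s0] := eqVneq (speed (ccoord c rho)) 0; last by left.
by right; split=> //; split=> //; split=> //; exact: transverse_or_curved.
Qed.

End slice.

Theorem corollary1p2 (R : realType) (n : nat) (M : manifold R n.+1)
    (g : metric M) (H : set M) (rho0 : cosphere g)
    (phi : R -> cosphere g -> cosphere g)
    (mu : probability (borel_cosphere rho0) R) :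
  compact [set: M] ->
  hypersurface H ->
  geodesic_flow phi ->
  flow_invariant phi mu ->
  second_ff_nondegenerate g H ->
  exists mSH : measurable (cosphere_over g H : set (borel_cosphere rho0)),
    forall A : set (borel_cosphere rho0), measurable A ->
      mrestr mu mSH A = 0%E.
Proof.
move=> _ hypH flow inv nondeg.
have [f [f_slice f_cover]] := @second_countable_cover M (chart R M n.+1)
  (slice_chart H) (fun c => cdom c) (@msecond_countable _ _ M)
  (fun c _ => cdom_open c).
pose S k : set (borel_cosphere rho0) := if f k is Some c
  then [set rho : cosphere g | cdom c (base rho) /\ H (base rho)] else set0.
have SE : cosphere_over g H = \bigcup_k S k.
  apply/seteqP; split=> [rho Hr|rho [k _]]; last first.
    by rewrite /S; case: (f k) => // c [].
  have [c Hc cr] := hypH _ Hr.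
  have [k [c' [fk c'r]]] := f_cover _ _ Hc cr.
  by exists k => //; rewrite /S fk.
have mS k : measurable (S k).
  rewrite /S; case fk : (f k) => [c|]; last exact: measurable0.
  exact: slice_measurable (f_slice _ _ fk).
have nS k : mu.-negligible (S k).
  rewrite /S; case fk : (f k) => [c|]; last exact: negligible_set0.
  exact: (@slice_negligible R n M g H rho0 phi mu flow inv c
    (f_slice _ _ fk) nondeg).
have mSH : measurable (cosphere_over g H : set (borel_cosphere rho0)).
  by rewrite SE; exact: bigcupT_measurable.
have nSH : mu.-negligible (cosphere_over g H : set (borel_cosphere rho0)).
  by rewrite SE; exact: negligible_bigcup.
exists mSH => A mA.
have mASH := @measurableI _ (borel_cosphere rho0) _ _ mA mSH.
exact: measure_negligible mASH (negligibleS (@subIsetr _ _ _) nSH).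
Qed.
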